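(* Assume the network is connected and that the linear system $$\begin{bmatrix} \dot{I}^m \\ \dot{U}^d \end{bmatrix}=\begin{bmatrix} -D^{-1}(E+YR) & D^{-1}Y \\ -\Psi L \Upsilon^{-1}+\Phi L \Upsilon^{-1} D^{-1}(E+YR) & -\Phi L \Upsilon^{-1}D^{-1}Y \end{bmatrix}\begin{bmatrix} I^m \\ U^d \end{bmatrix}$$ is semistable. Given $I^m(0)=0$ and $Y_s\ne 0$, let $r_{c1}$ be the common steady-state current ratio $\lim_{t\to\infty} i_k^m(t)/I_k^{max}$ (the same for all $k$), equal to $$r_{c1}=\frac{\underline{1}_n^T\Psi^{-1}U^d(0)}{\underline{1}_n^T\Psi^{-1}(Y^{-1}+R)\Upsilon\underline{1}_n},$$ and let $U=\lim_{t\to\infty}(U^d(t)-RI^m(t))=r_{c1}Y^{-1}\Upsilon\underline{1}_n$ be the steady output voltage vector. Then: P1) If $(E+YR)^{-1}YU^d(0)\preceq I^{max}$, then $r_{c1}<1$ and $r_{c1}\in[\underline{R}_{cr}^{Dec},\overline{R}_{cr}^{Dec}]$. P2) If $(E+YR)^{-1}YU^d(0)\preceq I^{max}$, then $\frac{r_{c1}}{\overline{R}_{cr}^{Dec}}U^{ss}\preceq U\preceq\frac{r_{c1}}{\underline{R}_{cr}^{Dec}}U^{ss}$. P3) If $\Psi=\beta E$ and $R=rE$, then $r_{c1}<\dfrac{\sum_k U_k^d(0)}{\sum_k I_k^{max}}\dfrac{\lambda_n}{1+\lambda_nr}$, where $\lambda_n$ is the maximal eigenvalue of $Y$. P4) If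 $Y_s=gE$, $\Psi=\beta E$ and $R=rE$, then $r_{c1}=\dfrac{\sum_kU_k^d(0)}{\sum_kI_k^{max}}\dfrac{g}{1+gr}$. P5) All nodes have the same (steady) output voltage if and only if there is a positive scalar $\epsilon$ such that $\Upsilon=\epsilon Y_s$.
   Context: Network. Let $\mathcal{N}=\{1,\dots,n\}$ be the set of generator nodes of a DC microgrid. Branch conductances $G_{kj}=G_{jk}\ge 0$ ($k\ne j$) and shunt conductances $G_{kk}\ge 0$ are given. The conductance matrix is $Y=[Y_{kj}]=Y_s+Y_c\in\mathbb{R}^{n\times n}$, with $Y_s=\mathrm{diag}(G_{11},\dots,G_{nn})$ and $Y_c$ the symmetric matrix with off-diagonal entries $-G_{kj}$ and diagonal entries $\sum_{j\ne k}G_{kj}$. The network is connected if the graph on $\mathcal{N}$ with an edge $\{k,j\}$ whenever $G_{kj}>0$ is connected (then $Y$ is invertible when $Y_s\neq 0$). Information graph Laplacian. $L=(l_{ij})\in\mathbb{R}^{n\times n}$ has, for $i\neq j$, $l_{ij}=-1$ if $Y_{ij}\ne 0$ and $l_{ij}=0$ otherwise, and $l_{ii}=-\sum_{j\ne i}l_{ij}$. Parameters. $E$ is the identity matrix; $\underline{1}_n\in\mathbb{R}^n$ is the all-ones vector; $D=\mathrm{diag}(\tau_1,\dots,\tau_n)$ with $\tau_k>0$; $R=\mathrm{diag}(R_1,\dots,R_n)$ with virtual resistances $R_k>0$; $\Upsilon=\mathrm{diag}(I_1^{max},\dots,I_n^{max})$ with maximum currents $I_k^{max}>0$, and $I^{max}=(I_1^{max},\dots,I_n^{max})^T$;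 $\Phi=\mathrm{diag}(\alpha_1,\dots,\alpha_n)$, $\alpha_k>0$; $\Psi=\mathrm{diag}(\beta_1,\dots,\beta_n)$, $\beta_k>0$. $I^m=(i_1^m,\dots,i_n^m)^T$ is the vector of measured currents, $U^d\in\mathbb{R}^n$ the vector of rated output voltages, with components $U_k^d$; the output voltage vector is $U(t)=U^d(t)-RI^m(t)$. The relation $\preceq$ is the componentwise order on vectors. Decentralized steady state. Under decentralized droop control with constant rated voltage $U^d(0)$, the steady current is $(E+YR)^{-1}YU^d(0)$, the steady output voltage is $U^{ss}=(E+RY)^{-1}U^d(0)$, and the steady current ratio vector is $R_{cr}^{Dec}=\Upsilon^{-1}(E+YR)^{-1}YU^d(0)$. $\overline{R}_{cr}^{Dec}$ and $\underline{R}_{cr}^{Dec}$ denote the maximum and minimum entries of $R_{cr}^{Dec}$. Semistability. A linear system $\dot z=Az$ is semistable if $\lim_{t\to\infty}z(t)$ exists for every initial condition $z(0)$.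
   Formalization: Conditions added where the claim fails: P1 r_c1<1 needs (E+YR)^{-1}YU^d(0)≠I^max; P2 lower bound needs Σ U_k^d(0)/β_k>0, upper bound needs min R_cr^Dec>0; P3 needs n≥2 and Σ U_k^d(0)>0; P5 needs Σ U_k^d(0)/β_k≠0. *)

(* Defs.v *)
From HB Require Import structures.
From mathcomp Require Import all_boot all_order all_algebra.
From mathcomp Require Import all_classical all_reals all_analysis.

Set Implicit Arguments.
Unset Strict Implicit.
Unset Printing Implicit Defensive.

Import Order.TTheory GRing.Theory Num.Theory.
Import numFieldNormedType.Exports.

Local Open Scope classical_set_scope.
Local Open Scope ring_scope.

Definition diagc (R : realType) (n : nat) (v : 'cV[R]_n) : 'M[R]_n :=
  diag_mx v^T.

Definition ones (R : realType) (n : nat) : 'cV[R]_n := const_mx 1.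

Definition vle (R : realType) (n : nat) (u v : 'cV[R]_n) : Prop :=
  forall k, u k 0 <= v k 0.

Definition vmax (R : realType) (n : nat) (v : 'cV[R]_n.+1) : R :=
  \big[Num.max/v ord0 0]_(k < n.+1) v k 0.

Definition vmin (R : realType) (n : nat) (v : 'cV[R]_n.+1) : R :=
  \big[Num.min/v ord0 0]_(k < n.+1) v k 0.

Definition entry_sum (R : realType) (n : nat) (v : 'cV[R]_n) : R :=
  \sum_k v k 0.

(* [G] stores all conductances: [G k j], k != j, is the branch conductance
   between k and j, and the diagonal entry [G k k] is the shunt conductance
   at k. *)
Definition shunt_mx (R : realType) (n : nat) (G : 'M[R]_n) : 'M[R]_n :=
  diag_mx (\row_k G k k).

Definition coupling_mx (R : realType) (n : nat) (G : 'M[R]_n) : 'M[R]_n :=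
  \matrix_(k, j) if k == j then \sum_(i | i != k) G k i else - G k j.

Definition conductance_mx (R : realType) (n : nat) (G : 'M[R]_n) : 'M[R]_n :=
  shunt_mx G + coupling_mx G.

Definition network_connected (R : realType) (n : nat) (G : 'M[R]_n) : Prop :=
  forall k j : 'I_n, connect (fun a b => (a != b) && (0 < G a b)) k j.

Definition info_laplacian (R : realType) (n : nat) (Y : 'M[R]_n) : 'M[R]_n :=
  let l i j : R := if Y i j != 0 then -1 else 0 in
  \matrix_(i, j) if i == j then - \sum_(k | k != i) l i k else l i j.

Definition max_eigenvalue (R : realType) (n : nat) (A : 'M[R]_n) (a : R) : Prop :=
  eigenvalue A a /\ forall b, eigenvalue A b -> b <= a.

(* Trajectories of z' = A z on [0, +oo[; the values of [z] at negative times
   are irrelevant. *)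
Definition trajectory (R : realType) (m : nat) (A : 'M[R]_m)
    (z : R -> 'cV[R]_m) : Prop :=
  {within `[0, +oo[, continuous z} /\
  forall t : R, 0 < t -> is_derive t 1 z (A *m z t).

Definition semistable (R : realType) (m : nat) (A : 'M[R]_m) : Prop :=
  forall z : R -> 'cV[R]_m, trajectory A z -> cvg (z t @[t --> +oo]).

(* State matrix of the closed loop, acting on the stacked vector (I^m, U^d).
   [Rv] is the diagonal matrix of virtual resistances. *)
Definition closed_loop_mx (R : realType) (n : nat)
    (Y D Rv Upsilon Phi Psi : 'M[R]_n) : 'M[R]_(n + n) :=
  let L := info_laplacian Y in
  let iD := invmx D in
  let iUpsilon := invmx Upsilon in
  block_mx
    (- (iD *m (1%:M + Y *m Rv)))
    (iD *m Y)
    (- (Psi *m L *m iUpsilon) + Phi *m L *m iUpsilon *m iD *m (1%:M + Y *m Rv))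
    (- (Phi *m L *m iUpsilon *m iD *m Y)).

Definition dec_current (R : realType) (n : nat) (Y Rv : 'M[R]_n)
    (Ud0 : 'cV[R]_n) : 'cV[R]_n :=
  invmx (1%:M + Y *m Rv) *m Y *m Ud0.

Definition dec_voltage (R : realType) (n : nat) (Y Rv : 'M[R]_n)
    (Ud0 : 'cV[R]_n) : 'cV[R]_n :=
  invmx (1%:M + Rv *m Y) *m Ud0.

Definition dec_ratio (R : realType) (n : nat) (Y Rv Upsilon : 'M[R]_n)
    (Ud0 : 'cV[R]_n) : 'cV[R]_n :=
  invmx Upsilon *m dec_current Y Rv Ud0.

Definition steady_ratio (R : realType) (n : nat) (Y Rv Upsilon Psi : 'M[R]_n)
    (Ud0 : 'cV[R]_n) : R :=
  ((ones R n)^T *m invmx Psi *m Ud0) 0 0 /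
  ((ones R n)^T *m invmx Psi *m (invmx Y + Rv) *m Upsilon *m ones R n) 0 0.

(* Main.v *)
Require Import Defs.
From HB Require Import structures.
From mathcomp Require Import all_boot all_order all_algebra.
From mathcomp Require Import all_classical all_reals all_analysis.
From mathcomp Require Import ring lra.

Set Implicit Arguments.
Unset Strict Implicit.
Unset Printing Implicit Defensive.

Import Order.TTheory GRing.Theory Num.Theory.
Import numFieldNormedType.Exports.

Local Open Scope classical_set_scope.
Local Open Scope ring_scope.

(* A semistable trajectory converges to an equilibrium, where the currents are
   proportional to I^max because the kernel of the Laplacian is spanned by the
   ones vector; the factor is r_c1 because
     1^T Psi^-1 (U^d + Phi L Upsilon^-1 I^m)
   is conserved.  With M = Y^-1 + R and phi v = 1^T Psi^-1 v, the decentralized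
   current satisfies M I^dec = U^d(0), so
     r_c1 = phi (M I^dec) / phi (M I^max)
   and x |-> phi (M x) is a positive functional, since a minimum principle
   makes Y^-1 entrywise nonnegative: this gives P1 and P2.  For P3, at an
   argmin k of w = Y^-1 1 one has w >= 1 / G_kk > 1 / Y_kk >= 1 / lambda_n. *)

(** * Conductance matrices *)

Lemma conductance_mulE (R : realType) (n : nat) (G : 'M[R]_n) (x : 'cV[R]_n) k :
  (conductance_mx G *m x) k 0 =
  G k k * x k 0 + \sum_(j | j != k) G k j * (x k 0 - x j 0).
Proof.
rewrite mulmxDl mxE mul_diag_mx !mxE; congr (_ + _).
rewrite (bigD1 k)//= !mxE eqxx mulr_suml -big_split/=.
apply: eq_bigr => j jk; rewrite !mxE eq_sym (negPf jk); ring.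
Qed.

Lemma conductance_mxE (R : realType) (n : nat) (G : 'M[R]_n) k j :
  conductance_mx G k j =
  if k == j then G k k + \sum_(i | i != k) G k i else - G k j.
Proof.
by rewrite !mxE; case: eqP => [->|]; rewrite ?mulr1n// mulr0n add0r.
Qed.

Lemma conductance_sym (R : realType) (n : nat) (G : 'M[R]_n) :
  (forall k j, G k j = G j k) -> (conductance_mx G)^T = conductance_mx G.
Proof.
move=> Gs; apply/matrixP => k j; rewrite mxE !conductance_mxE eq_sym Gs.
by case: eqP => [->|].
Qed.

(** Induction along a path from [k0]. In this form connectivity spreads a local property, such as
    attaining the minimum, over the whole network. *)
Lemma connected_ind (R : realType) (n : nat) (G : 'M[R]_n) (P : pred 'I_n) k0 :
  network_connected G -> P k0 ->
  (forall k j, P k -> j != k -> 0 < G k j -> P j) -> forall j, P j.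
Proof.
move=> conn P0 step j.
have /connectP[p] := conn k0 j.
elim: p k0 P0 => /= [|b p IH] a Pa; first by move=> _ ->.
move=> /andP[/andP[ab Gab] pth]; apply: IH => //; apply: step Pa _ Gab.
by rewrite eq_sym.
Qed.

Lemma exists_argmin (R : realType) (n : nat) (x : 'cV[R]_n.+1) :
  exists k, forall j, x k 0 <= x j 0.
Proof.
have [k _ kP] := @arg_minP _ _ _ (ord0 : 'I_n.+1) xpredT (fun k => x k 0) isT.
by exists k => j; exact: kP.
Qed.

Section network.
Context (R : realType) (n : nat) (G : 'M[R]_n.+1).
Hypotheses (G_ge0 : forall k j, 0 <= G k j) (conn : network_connected G).
Let Y := conductance_mx G.

(* Minimum principle: at a nonpositive minimum all terms of
   [conductance_mulE] are nonpositive. *)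
Lemma conductance_min_principle (x : 'cV[R]_n.+1) k :
  vle 0 (Y *m x) -> x k 0 <= 0 -> (forall j, x k 0 <= x j 0) ->
  forall j, x j 0 = x k 0.
Proof.
move=> Yx xk0 xmin j; apply/eqP; move: j.
apply: (connected_ind (k0 := k) conn) => // i j /eqP xi ji Gij.
have := Yx i; rewrite mxE conductance_mulE xi (bigD1 j)//= => Yxi.
have h1 : G i i * x k 0 <= 0 by rewrite mulr_ge0_le0.
have h2 : \sum_(l | (l != i) && (l != j)) G i l * (x k 0 - x l 0) <= 0.
  by apply: sumr_le0 => l _; rewrite mulr_ge0_le0// subr_le0.
have h3 : 0 <= G i j * (x k 0 - x j 0) by lra.
by move: h3; rewrite pmulr_rge0// subr_ge0 eq_le xmin => ->.
Qed.

(** Without shunts a constant shift of [x] leaves [Y *m x] unchanged, so the minimum can be moved to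
    0, where the minimum principle applies. *)
Lemma conductance_kernel_const (x : 'cV[R]_n.+1) :
  (forall k, G k k = 0) -> Y *m x = 0 -> forall i j, x i 0 = x j 0.
Proof.
move=> G0 Yx.
have [k kmin] := exists_argmin x.
pose x' := x - const_mx (x k 0).
suff xE i : x i 0 = x k 0 by move=> i j; rewrite !xE.
have : x' i 0 = x' k 0.
  apply: conductance_min_principle; last 2 first.
  - by rewrite !mxE subrr.
  - by move=> j; rewrite !mxE lerD2r.
  move=> j; rewrite mxE conductance_mulE.
  have := congr1 (fun v : 'cV_n.+1 => v j 0) Yx.
  rewrite [RHS]mxE conductance_mulE G0 !mul0r !add0r => e; rewrite -[leLHS]e.
  rewrite le_eqVlt; apply/orP; left.
  by apply/eqP/eq_bigr => l _; rewrite !mxE; ring.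
by rewrite !mxE => /addIr.
Qed.

Hypothesis shunt_neq0 : shunt_mx G != 0.

Lemma shunt_gt0 : exists k, 0 < G k k.
Proof.
apply/existsP; apply: contraNT shunt_neq0; rewrite negb_exists => /forallP G0.
apply/eqP/matrixP => i j; rewrite !mxE; case: eqP => // _.
by apply/eqP; rewrite mulr1n eq_le G_ge0 andbT leNgt G0.
Qed.

(** A negative minimum would make [x] constant, and at a node with a positive shunt the entry of
    [Y *m x] would then be negative. *)
Lemma conductance_inv_ge0 (x : 'cV[R]_n.+1) : vle 0 (Y *m x) -> vle 0 x.
Proof.
move=> Yx j; rewrite mxE.
have [k kmin] := exists_argmin x; apply: le_trans (kmin j).
rewrite leNgt; apply/negP => xk.
have xE := conductance_min_principle Yx (ltW xk) kmin.
have [i Gi] := shunt_gt0.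
have := Yx i; rewrite mxE conductance_mulE xE big1 => [|l _]; last first.
  by rewrite xE subrr mulr0.
by rewrite addr0 pmulr_rge0// leNgt xk.
Qed.

(** If [Y u = 0], the previous lemma applies to both [u] and [-u], which forces [u = 0]. *)
Lemma conductance_unit : Y \in unitmx.
Proof.
rewrite -unitmx_tr -row_free_unit; apply/row_freeP.
apply/row_freeP; rewrite -kermx_eq0; apply/eqP/row_matrixP => i.
set u := row i _; rewrite row0.
have Yu : Y *m u^T = 0.
  by rewrite -[Y]trmxK -trmx_mul -row_mul mulmx_ker row0 trmx0.
apply/trmx_inj/colP => j; rewrite trmx0 [RHS]mxE; apply/eqP; rewrite eq_le.
have := @conductance_inv_ge0 u^T; rewrite Yu => /(_ (fun _ => lexx _)) /(_ j).
have := @conductance_inv_ge0 (- u^T); rewrite mulmxN Yu oppr0.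
by move=> /(_ (fun _ => lexx _)) /(_ j); rewrite !mxE oppr_ge0 => -> ->.
Qed.

Lemma conductance_invmx_ge0 (x : 'cV[R]_n.+1) :
  vle 0 x -> vle 0 (invmx Y *m x).
Proof.
move=> x0; apply: conductance_inv_ge0.
by rewrite mulmxA mulmxV ?mul1mx// conductance_unit.
Qed.

Lemma conductance_invmx_le (x y : 'cV[R]_n.+1) :
  vle x y -> vle (invmx Y *m x) (invmx Y *m y).
Proof.
move=> xy k; rewrite -subr_ge0.
have := @conductance_invmx_ge0 (y - x); rewrite mulmxBr => /(_ _ k).
by rewrite !mxE; apply=> j; rewrite !mxE subr_ge0.
Qed.

(** At an argmin [k] of [w] the branch terms in row [k] of [Y w = 1] are nonpositive, so the shunt
    term alone is at least 1. *)
Lemma conductance_invmx_ones_ge :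
  exists2 k, 0 < G k k &
    forall j, (G k k)^-1 <= (invmx Y *m ones R n.+1) j 0.
Proof.
set w := invmx Y *m _.
have Yw : Y *m w = ones R n.+1
  by rewrite mulmxA mulmxV ?mul1mx// conductance_unit.
have w0 : vle 0 w by apply: conductance_invmx_ge0 => j; rewrite !mxE ler01.
have [k kmin] := exists_argmin w; exists k.
all: have := congr1 (fun v : 'cV_n.+1 => v k 0) Yw.
all: rewrite conductance_mulE [RHS]mxE => Ywk.
all: have h : \sum_(l | l != k) G k l * (w k 0 - w l 0) <= 0 by
  apply: sumr_le0 => l _; rewrite mulr_ge0_le0// subr_le0.
all: have h1 : 1 <= G k k * w k 0 by lra.
all: have Gk : 0 < G k k by
  rewrite lt0r G_ge0 andbT; apply/eqP => G0; move: h1; rewrite G0 mul0r ler10.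
  by [].
move=> j; apply: le_trans (kmin j); rewrite -[leLHS]mul1r ler_pdivrMr//.
by rewrite mulrC.
Qed.

End network.

(** * Trajectories of linear systems *)

Lemma cvg_mx_coord (R : realType) (m n : nat) (T : Type) (F : set_system T)
    {FF : Filter F} (f : T -> 'M[R]_(m, n)) (l : 'M[R]_(m, n)) :
  f @ F --> l <-> forall i j, f t i j @[t --> F] --> l i j.
Proof.
split=> [fl i j|fl].
  exact: (cvg_comp _ _ fl (@coord_continuous _ _ _ i j l)).
apply/cvgrPdist_le => /= e e0; near=> t.
rewrite /Num.Def.normr/= mx_normrE (bigmax_le _ (ltW e0))//= => i _.
rewrite !mxE/=; move: i; near: t; apply: filter_forall => /= i.
exact: ((cvgrPdist_le _ _).1 (fl i.1 i.2)).
Unshelve. all: by end_near. Qed.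

Lemma cvg_mulmx (R : realType) (m n p : nat) (T : Type) (F : set_system T)
    {FF : Filter F} (f : T -> 'M[R]_(m, n)) (g : T -> 'M[R]_(n, p))
    (l : 'M[R]_(m, n)) (h : 'M[R]_(n, p)) :
  f @ F --> l -> g @ F --> h -> f t *m g t @[t --> F] --> l *m h.
Proof.
move=> /cvg_mx_coord fl /cvg_mx_coord gh; apply/cvg_mx_coord => i j.
rewrite !mxE; under eq_fun do rewrite mxE.
apply: cvg_big => [|k _]; first exact: add_continuous.
by apply: cvgM; [exact: fl|exact: gh].
Qed.

Lemma cvg_mulmxr (R : realType) (m n p : nat) (T : Type) (F : set_system T)
    {FF : Filter F} (A : 'M[R]_(m, n)) (f : T -> 'M[R]_(n, p))
    (l : 'M[R]_(n, p)) :
  f @ F --> l -> A *m f t @[t --> F] --> A *m l.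
Proof. by apply: cvg_mulmx; exact: cvg_cst. Qed.

Lemma cvg_trmx (R : realType) (m n : nat) (T : Type) (F : set_system T)
    {FF : Filter F} (f : T -> 'M[R]_(m, n)) (l : 'M[R]_(m, n)) :
  f @ F --> l -> (f t)^T @[t --> F] --> l^T.
Proof.
move=> /cvg_mx_coord fl; apply/cvg_mx_coord => i j.
by rewrite mxE; under eq_fun do rewrite mxE; exact: fl.
Qed.

(** By the mean value theorem on a unit interval far out, [f (a + 1) - f a], which is small, equals
    some [df c], which is close to [d]. *)
Lemma derive_cvg_eq0 (R : realType) (f df : R -> R) (l d : R) :
  (forall t : R, 0 < t -> is_derive t 1 f (df t)) ->
  f t @[t --> +oo] --> l -> df t @[t --> +oo] --> d -> d = 0.
Proof.
move=> fdf fl dfd; apply/eqP; rewrite -normr_eq0 eq_le normr_ge0 andbT.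
apply/ler_addgt0Pr => e e0; rewrite add0r.
(* Three errors add up: those of [f] at both ends of the interval and that of [df] at [c]. *)
have e3 : 0 < e / 3 by lra.
have : \forall t \near +oo,
    [/\ 0 < t, `|l - f t| <= e / 3 & `|d - df t| <= e / 3].
  near=> t; split; near: t; first exact: nbhs_pinfty_gt.
    by move/cvgrPdist_le: fl; apply.
  by move/cvgrPdist_le: dfd; apply.
move=> [M [Mr MP]].
pose a := M + 1; have Ma : M < a by rewrite /a; lra.
have aP t : a <= t -> [/\ 0 < t, `|l - f t| <= e / 3 & `|d - df t| <= e / 3].
  by move=> at_; apply: MP; lra.
have [a0 fa _] := aP a (lexx _).
have aa1 : a < a + 1 by lra.
have fE x : x \in `]a, (a + 1)[%R -> is_derive x 1 f (df x).
  by rewrite in_itv/= => /andP[ax _]; apply: fdf; lra.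
have cf : {within `[a, (a + 1)], continuous f}.
  apply: derivable_within_continuous => x; rewrite in_itv/= => /andP[ax _].
  have x0 : 0 < x by lra.
  by have [] := fdf x x0.
have [c] := MVT aa1 fE cf.
rewrite in_itv/= => /andP[ac _].
rewrite [a + 1 - a]addrAC subrr add0r mulr1 => {}fE.
have [_ _ dc] := aP c (ltW ac); have [_ fa1 _] := aP (a + 1) (ltW aa1).
move: fa fa1 dc; rewrite !ler_norml => /andP[? ?] /andP[? ?] /andP[? ?].
by apply/andP; split; lra.
Unshelve. all: by end_near. Qed.

(** Mean value theorem on [[0, t]]: the derivative is known at positive times only, and continuity
    at 0 brings in the initial value. *)
Lemma derive0_cst_itvcy (R : realType) (f : R -> R) (t : R) :
  {within `[0, +oo[, continuous f} ->
  (forall t : R, 0 < t -> is_derive t 1 f 0) ->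
  0 <= t -> f t = f 0.
Proof.
move=> cf f0 t0; apply/eqP; rewrite -subr_eq0.
have [| |c _ ->] := @MVT_segment _ f (fun=> 0) 0 t t0; last by rewrite mul0r.
- by move=> x; rewrite in_itv/= => /andP[x0 _]; exact: f0.
- apply: continuous_subspaceW cf => x /=; rewrite !in_itv/= => /andP[-> _].
  by [].
Qed.

Section trajectory.
Context (R : realType) (m : nat) (A : 'M[R]_m) (z : R -> 'cV[R]_m).
Hypothesis zA : trajectory A z.

Lemma trajectory_derive_lin p (c : 'M[R]_(p, m)) i (t : R) : 0 < t ->
  is_derive t 1 (fun s => (c *m z s) i 0) ((c *m A *m z t) i 0).
Proof.
move=> t0; have [zd zE] := zA.2 t t0.
(* Written as a sum of scaled scalar functions, the product is open to the sum and scaling rules for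
   derivatives. *)
have -> : (fun s => (c *m z s) i 0) =
    \sum_(j < m) (fun s => c i j *: (z s j 0 : R^o)).
  by apply/funext => s; rewrite mxE fct_sumE.
rewrite -mulmxA mxE; apply: is_derive_sum => j.
apply: is_deriveZ; apply: DeriveDef; first by move/derivable_mxP : zd; apply.
by rewrite -zE derive_mx// mxE.
Qed.

Lemma trajectory_continuous_lin p (c : 'M[R]_(p, m)) i :
  {within `[0, +oo[, continuous (fun s => (c *m z s) i 0)}.
Proof.
by move=> t; exact: ((cvg_mx_coord _ _).1 (cvg_mulmxr (zA.1 t))).
Qed.

(** Each coordinate of [z] converges, and its derivative converges to that coordinate of [A *m zl],
    which must therefore be 0. *)
Lemma trajectory_lim_ker (zl : 'cV[R]_m) :
  z t @[t --> +oo] --> zl -> A *m zl = 0.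
Proof.
move=> zzl; apply/colP => i; rewrite [RHS]mxE.
apply: (@derive_cvg_eq0 _ (fun t => (1%:M *m z t) i 0)
  (fun t => (A *m z t) i 0)).
- by move=> t t0; have := trajectory_derive_lin 1%:M i t0; rewrite mul1mx.
- exact: ((cvg_mx_coord _ _).1 (cvg_mulmxr zzl)).
- exact: ((cvg_mx_coord _ _).1 (cvg_mulmxr zzl)).
Qed.

(** The derivative [c *m A *m z] vanishes, so [c *m z] keeps its initial value up to the limit. *)
Lemma trajectory_lim_invariant p (c : 'M[R]_(p, m)) (zl : 'cV[R]_m) :
  c *m A = 0 -> z t @[t --> +oo] --> zl -> c *m zl = c *m z 0.
Proof.
move=> cA zzl; apply/colP => i.
have cz : (c *m z t) i 0 @[t --> +oo] --> (c *m zl) i 0.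
  exact: ((cvg_mx_coord _ _).1 (cvg_mulmxr zzl)).
rewrite -[LHS](cvg_lim (@Rhausdorff R) cz); apply: (cvg_lim (@Rhausdorff R)).
apply: (@cvg_trans _ (((c *m z 0) i 0) @[t --> (+oo : set_system R)])).
  2: exact: cvg_cst.
apply: near_eq_cvg; near=> t; apply/esym.
apply: (derive0_cst_itvcy (f := fun s => (c *m z s) i 0)).
- exact: trajectory_continuous_lin.
- by move=> s s0; have := trajectory_derive_lin c i s0; rewrite cA mul0mx mxE.
- by near: t; exact: nbhs_pinfty_ge.
Unshelve. all: by end_near. Qed.

End trajectory.

(** * The largest eigenvalue of a symmetric matrix *)

Lemma dotrE (R : realType) n (u v : 'rV[R]_n) :
  (u *m v^T) 0 0 = \sum_i u 0 i * v 0 i.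
Proof. by rewrite mxE; apply: eq_bigr => i _; rewrite mxE. Qed.

Lemma dotr_ge0 (R : realType) n (u : 'rV[R]_n) : 0 <= (u *m u^T) 0 0.
Proof. by rewrite dotrE sumr_ge0// => i _; rewrite -expr2 sqr_ge0. Qed.

Lemma dotr_eq0 (R : realType) n (u : 'rV[R]_n) : (u *m u^T) 0 0 = 0 -> u = 0.
Proof.
rewrite dotrE => /eqP; rewrite psumr_eq0 => [/allP u0|i _]; last first.
  by rewrite -expr2 sqr_ge0.
apply/rowP => i; rewrite mxE; apply/eqP; rewrite -sqrf_eq0 expr2.
by have := u0 i; rewrite mem_index_enum => /(_ isT).
Qed.

Lemma cvg_quad_form (R : realType) n (M : 'M[R]_n) (T : Type)
    (F : set_system T) {FF : Filter F} (f : T -> 'rV[R]_n) (u : 'rV[R]_n) :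
  f @ F --> u -> (f t *m M *m (f t)^T) 0 0 @[t --> F] --> (u *m M *m u^T) 0 0.
Proof.
move=> fu.
suff uM : (f t *m M *m (f t)^T) @[t --> F] --> u *m M *m u^T.
  exact: ((cvg_mx_coord _ _).1 uM).
by apply: cvg_mulmx; [apply: cvg_mulmx; [|exact: cvg_cst]|exact: cvg_trmx].
Qed.

Lemma quad_form_continuous (R : realType) n (M : 'M[R]_n) :
  continuous (fun u : 'rV[R]_n => (u *m M *m u^T) 0 0).
Proof. by move=> u; exact: (@cvg_quad_form _ _ _ _ (nbhs u) _ id u cvg_id). Qed.

(** Heine-Borel: every entry has absolute value at most 1, and the sphere is the preimage of 1 under
    the quadratic form of the identity. *)
Lemma unit_sphere_compact (R : realType) n :
  compact [set u : 'rV[R]_n | (u *m u^T) 0 0 = 1].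
Proof.
apply: bounded_closed_compact.
  exists 1; split => // M M1 u /= u1.
  rewrite /Num.Def.normr/= mx_normrE (bigmax_le _ (ltW (lt_trans ltr01 M1)))//=.
  move=> [i j] _ /=; rewrite ord1; apply: le_trans (ltW M1).
  rewrite -[leRHS]sqrtr1 -sqrtr_sqr ler_wsqrtr// -u1 dotrE (bigD1 j)//= expr2.
  by rewrite lerDl sumr_ge0// => k _; rewrite -expr2 sqr_ge0.
have := @closed_comp _ _ (fun u : 'rV[R]_n => (u *m 1%:M *m u^T) 0 0) [set 1].
under eq_fun do rewrite mulmx1.
move=> h; apply: h; last exact: closed_eq.
move=> u _; have := @quad_form_continuous _ _ 1%:M u.
by under eq_fun do rewrite mulmx1.
Qed.

(** With [h = v M], the form at [v + s h] is [2 s b + s^2 c], where [b = |h|^2]; unless [b = 0], a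
    small negative [s] would make it negative. *)
Lemma psd_isotropic_ker (R : realType) n (M : 'M[R]_n) (v : 'rV[R]_n) :
  M^T = M -> (forall u : 'rV[R]_n, 0 <= (u *m M *m u^T) 0 0) ->
  (v *m M *m v^T) 0 0 = 0 -> v *m M = 0.
Proof.
move=> Ms Mge0 v0; set h := v *m M; apply: dotr_eq0.
set b := (h *m h^T) 0 0; set c := (h *m M *m h^T) 0 0.
have c0 : 0 <= c by exact: Mge0.
have quad (s : R) : 0 <= 2 * s * b + s ^+ 2 * c.
  suff -> : 2 * s * b + s ^+ 2 * c =
      ((v + s *: h) *m M *m (v + s *: h)^T) 0 0 by exact: Mge0.
  have hv : (h *m M *m v^T) 0 0 = b.
    by rewrite /b [in RHS]/h trmx_mul Ms mulmxA.
  rewrite linearD/= linearZ/= mulmxDl -scalemxAl mulmxDr !mulmxDl.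
  rewrite -!scalemxAl -!scalemxAr -/h.
  have mxDE (x y : 'M[R]_1) : (x + y) 0 0 = x 0 0 + y 0 0 by rewrite mxE.
  have mxZE r (x : 'M[R]_1) : (r *: x) 0 0 = r * x 0 0 by rewrite mxE.
  by rewrite !(mxDE, mxZE) v0 hv -/b -/c; ring.
(* The minimizer would be [- b / c]; the denominator [c + 1] stays positive when [c = 0] and still
   gives a negative value for [b != 0]. *)
have := quad (- b / (c + 1)).
have -> : 2 * (- b / (c + 1)) * b + (- b / (c + 1)) ^+ 2 * c =
   - (b ^+ 2 * ((c + 2) / (c + 1) ^+ 2)).
  by field; rewrite gt_eqF//; lra.
rewrite oppr_ge0 pmulr_lle0; last by rewrite divr_gt0// ?exprn_gt0//; lra.
by move=> b2; apply/eqP; rewrite -sqrf_eq0 eq_le b2 sqr_ge0.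
Qed.

(* The maximum of the Rayleigh quotient is an eigenvalue. *)
Lemma sym_diag_le_max_eigenvalue (R : realType) n (A : 'M[R]_n.+1) (a : R) k :
  A^T = A -> max_eigenvalue A a -> A k k <= a.
Proof.
move=> As [_ amax].
have [|v vS vmax] := compact_EVT_max _ (@unit_sphere_compact R n.+1)
    (continuous_subspaceT (@quad_form_continuous R _ A)).
  by exists (delta_mx 0 0); rewrite /= trmx_delta mul_delta_mx mxE eqxx.
set mu := (v *m A *m v^T) 0 0 in vmax.
have v1 : (v *m v^T) 0 0 = 1 by rewrite inE in vS.
(* The maximality of [mu] on the sphere extends to all vectors by homogeneity. *)
have muP (u : 'rV[R]_n.+1) : (u *m A *m u^T) 0 0 <= mu * (u *m u^T) 0 0.
  have := dotr_ge0 u; rewrite le_eqVlt => /predU1P[/esym u0|u_gt0].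
    by rewrite u0 (dotr_eq0 u0) !mul0mx mxE mulr0.
  set s := Num.sqrt ((u *m u^T) 0 0).
  have s0 : 0 < s by rewrite sqrtr_gt0.
  have s2 : s ^+ 2 = (u *m u^T) 0 0 by rewrite sqr_sqrtr// ltW.
  have scale (M : 'M[R]_n.+1) : ((s^-1 *: u) *m M *m (s^-1 *: u)^T) 0 0 =
      (u *m M *m u^T) 0 0 / s ^+ 2.
    rewrite linearZ/= -!scalemxAl -scalemxAr !mxE.
    by rewrite mulrA -expr2 exprVn mulrC.
  have := vmax (s^-1 *: u); rewrite inE /= => /(_ _).
  rewrite scale -s2 ler_pdivrMr ?exprn_gt0//; apply.
  by have := scale 1%:M; rewrite !mulmx1 => ->; rewrite s2 divff// gt_eqF.
have formE (u : 'rV[R]_n.+1) : (u *m (mu%:M - A) *m u^T) 0 0 =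
    mu * (u *m u^T) 0 0 - (u *m A *m u^T) 0 0.
  by rewrite mulmxBr mulmxBl mul_mx_scalar -scalemxAl !mxE.
(* [mu E - A] is positive semidefinite and its form vanishes at [v], so [v] is an eigenvector of [A]
   for [mu]. *)
have vA : v *m (mu%:M - A) = 0.
  apply: psd_isotropic_ker.
  - by rewrite linearB/= tr_scalar_mx As.
  - by move=> u; rewrite formE subr_ge0.
  - by rewrite formE v1 mulr1 subrr.
have /amax : eigenvalue A mu.
  apply/eigenvalueP; exists v.
    by move/eqP: vA; rewrite mulmxBr subr_eq0 mul_mx_scalar => /eqP.
  by apply: contra_eq_neq v1 => ->; rewrite mul0mx mxE eq_sym oner_eq0.
apply: le_trans.
(* The form at the [k]-th unit vector is the diagonal entry [A k k]. *)
have := muP (delta_mx 0 k).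
rewrite trmx_delta mul_delta_mx [X in _ * X]mxE eqxx mulr1 -rowE.
rewrite -colE mxE mxE //.
Qed.

(** * The closed-loop microgrid *)

Lemma diagc_mulE (R : realType) n (v x : 'cV[R]_n) k :
  (diagc v *m x) k 0 = v k 0 * x k 0.
Proof. by rewrite mul_diag_mx !mxE. Qed.

Lemma diagc_ones (R : realType) n (v : 'cV[R]_n) : diagc v *m ones R n = v.
Proof. by apply/colP => k; rewrite diagc_mulE mxE mulr1. Qed.

Lemma diagc_mulV (R : realType) n (v : 'cV[R]_n) :
  (forall k, 0 < v k 0) -> diagc v *m diagc (\col_k (v k 0)^-1) = 1%:M.
Proof.
move=> v0; rewrite mulmx_diag -diag_const_mx; congr diag_mx.
by apply/rowP => k; rewrite !mxE divff// gt_eqF.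
Qed.

Lemma diagc_unit (R : realType) n (v : 'cV[R]_n) :
  (forall k, 0 < v k 0) -> diagc v \in unitmx.
Proof. by move=> /diagc_mulV/mulmx1_unit[]. Qed.

Lemma diagc_invmx (R : realType) n (v : 'cV[R]_n) :
  (forall k, 0 < v k 0) -> invmx (diagc v) = diagc (\col_k (v k 0)^-1).
Proof.
by move=> v0; rewrite -[LHS]mulmx1 -(diagc_mulV v0) mulKmx// diagc_unit.
Qed.

Lemma ones_dot (R : realType) n (v : 'cV[R]_n) :
  ((ones R n)^T *m v) 0 0 = entry_sum v.
Proof. by rewrite mxE; apply: eq_bigr => k _; rewrite !mxE mul1r. Qed.

Lemma vle_sub_ge0 (R : realType) n (u v : 'cV[R]_n) : vle u v -> vle 0 (v - u).
Proof. by move=> uv k; rewrite !mxE subr_ge0. Qed.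

Lemma vmax_ge (R : realType) n (v : 'cV[R]_n.+1) k : v k 0 <= vmax v.
Proof. exact: (le_bigmax (v ord0 0) (fun i => v i 0) k). Qed.

Lemma vmin_le (R : realType) n (v : 'cV[R]_n.+1) k : vmin v <= v k 0.
Proof. exact: (bigmin_le _ k (fun i => v i 0)). Qed.

(** The Laplacian is the conductance matrix of the network with the same edges, unit weights and no
    shunts, so the results on conductance matrices cover it. *)
Lemma info_laplacianE (R : realType) n (G : 'M[R]_n) :
  info_laplacian (conductance_mx G) =
  conductance_mx (\matrix_(k, j) ((k != j) && (G k j != 0))%:R).
Proof.
apply/matrixP => i j; rewrite [LHS]mxE [RHS]conductance_mxE !mxE.
case: eqP => [_|/eqP ij]; last first.
  by rewrite mulr0n add0r oppr_eq0; case: (G i j == 0); rewrite ?oppr0.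
rewrite eqxx add0r -sumrN; apply: eq_bigr => k; rewrite eq_sym => ki.
rewrite conductance_mxE mxE (negPf ki) oppr_eq0 /=.
by case: (G i k == 0); rewrite ?oppr0 ?opprK.
Qed.

Section microgrid.
Context (R : realType) (n : nat) (G : 'M[R]_n.+1).
Hypotheses (G_sym : forall k j, G k j = G j k) (G_ge0 : forall k j, 0 <= G k j)
  (conn : network_connected G).
Let Y := conductance_mx G.
Let L := info_laplacian Y.

Lemma info_laplacian_kernel (x : 'cV[R]_n.+1) :
  L *m x = 0 -> forall i j, x i 0 = x j 0.
Proof.
rewrite /L /Y info_laplacianE; apply: conductance_kernel_const.
- by move=> k j; rewrite mxE ler0n.
- move=> k j; apply: connect_sub (conn k j) => a b /andP[ab Gab].
  by rewrite connect1// ab mxE ab gt_eqF//= ltr01.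
- by move=> k; rewrite mxE eqxx.
Qed.

Lemma info_laplacian_ones_left : (ones R n.+1)^T *m L = 0.
Proof.
have L1 : L *m ones R n.+1 = 0.
  apply/colP => k; rewrite /L /Y info_laplacianE conductance_mulE.
  rewrite !mxE eqxx mul0r add0r big1// => j _.
  by rewrite !mxE subrr mulr0.
apply: trmx_inj; rewrite trmx_mul trmxK trmx0 -{}L1; congr (_ *m _).
rewrite /L /Y info_laplacianE conductance_sym// => k j.
by rewrite !mxE eq_sym G_sym.
Qed.

(** * The positive functional built from [Y^-1 + R] *)

Hypothesis shunt_neq0 : shunt_mx G != 0.
Context (res Imax beta : 'cV[R]_n.+1).
Hypotheses (res_gt0 : forall k, 0 < res k 0) (Imax_gt0 : forall k, 0 < Imax k 0)
  (beta_gt0 : forall k, 0 < beta k 0).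
Let Rv := diagc res.
Let Upsilon := diagc Imax.
Let Psi := diagc beta.
Let B := 1%:M + Y *m Rv.
Let M := invmx Y + Rv.

Let Y_unit : Y \in unitmx.
Proof. exact: conductance_unit. Qed.

(* [E + Y R = (Y + R^-1) R], and [Y + R^-1] is the conductance matrix of the
   network with [R^-1] added to the shunts. *)
Let B_unit : B \in unitmx.
Proof.
pose res' := \col_k (res k 0)^-1.
have -> : B = conductance_mx (G + diagc res') *m Rv.
  rewrite /B -(diagc_mulV res_gt0).
  have -> : conductance_mx (G + diagc res') = diagc res' + Y.
    apply/matrixP => k j; rewrite [RHS]mxE !conductance_mxE !mxE.
    case: eqP => [_|/eqP kj]; rewrite ?mulr1n ?mulr0n ?addr0 ?add0r//.
    rewrite eqxx mulr1n (addrC (G k k)) -addrA; congr (_ + (_ + _)).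
    by apply: eq_bigr => i ik; rewrite !mxE eq_sym (negPf ik) mulr0n addr0.
  by rewrite [RHS]mulmxDl; congr (_ + _); exact: diag_mxC.
rewrite unitmx_mul diagc_unit// andbT; apply: conductance_unit.
- move=> k j; rewrite !mxE addr_ge0//.
  by case: eqP => [->|]; rewrite ?mulr1n ?mulr0n ?invr_ge0// ltW.
- move=> k j; apply: connect_sub (conn k j) => a b /andP[ab Gab].
  by rewrite connect1// ab !mxE (negPf ab) mulr0n addr0.
- apply/eqP => /matrixP/(_ ord0 ord0); rewrite !mxE eqxx !mulr1n.
  by apply/eqP; rewrite gt_eqF// ltr_wpDl// invr_gt0.
Qed.

Let YM : Y *m M = B.
Proof. by rewrite /M mulmxDr mulmxV. Qed.

Let phi (v : 'cV[R]_n.+1) : R := ((ones R n.+1)^T *m invmx Psi *m v) 0 0.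

Lemma phiE v : phi v = \sum_k v k 0 / beta k 0.
Proof.
rewrite /phi -mulmxA ones_dot; apply: eq_bigr => k _.
by rewrite diagc_invmx// diagc_mulE mxE mulrC.
Qed.

Let phiM_scale a x : phi (M *m (a *: x)) = a * phi (M *m x).
Proof. by rewrite /phi -!scalemxAr mxE. Qed.

Let phiM_sub x y : phi (M *m (x - y)) = phi (M *m x) - phi (M *m y).
Proof. by rewrite /phi !mulmxBr !mxE. Qed.

Let M_ge x : vle 0 x -> vle (Rv *m x) (M *m x).
Proof.
move=> x0 k; rewrite mulmxDl [leRHS]mxE lerDr.
by have := conductance_invmx_ge0 G_ge0 conn shunt_neq0 x0 k; rewrite mxE.
Qed.

Let phiM_ge0 x : vle 0 x -> 0 <= phi (M *m x).
Proof.
move=> x0; rewrite phiE sumr_ge0// => k _.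
rewrite divr_ge0 ?(ltW (beta_gt0 k))//.
apply: le_trans (M_ge x0 k); rewrite diagc_mulE mulr_ge0 ?(ltW (res_gt0 _))//.
by have := x0 k; rewrite mxE.
Qed.

Let phiM_gt0 x : vle 0 x -> x != 0 -> 0 < phi (M *m x).
Proof.
move=> x0 xn0; rewrite lt0r phiM_ge0// andbT; apply: contra_neq xn0 => p0.
apply/colP => k; rewrite mxE; apply/eqP; rewrite eq_le.
have xk l : 0 <= x l 0 by have := x0 l; rewrite mxE.
rewrite xk andbT leNgt; apply/negP => xk0.
suff : 0 < phi (M *m x) by rewrite p0 ltxx.
(* Node [k] contributes a positive amount through [res k 0 * x k 0]; the other terms are
   nonnegative. *)
rewrite phiE (bigD1 k)//= ltr_wpDr//.
  rewrite sumr_ge0// => j _; rewrite divr_ge0 ?(ltW (beta_gt0 j))//.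
  apply: le_trans (M_ge x0 j).
  by rewrite diagc_mulE mulr_ge0 ?(ltW (res_gt0 _))//.
rewrite divr_gt0//; apply: lt_le_trans (M_ge x0 k).
by rewrite diagc_mulE mulr_gt0.
Qed.

Let Imax_ge0 : vle 0 Imax.
Proof. by move=> k; rewrite mxE ltW. Qed.

Let phiMImax_gt0 : 0 < phi (M *m Imax).
Proof.
apply: phiM_gt0 => //; apply/eqP => /colP/(_ ord0); rewrite mxE.
by apply/eqP; rewrite gt_eqF.
Qed.

(** * Comparison with the decentralized steady state *)

Context (Ud0 : 'cV[R]_n.+1).
Let Idec := dec_current Y Rv Ud0.
Let Rcr := dec_ratio Y Rv Upsilon Ud0.
Let rc1 := steady_ratio Y Rv Upsilon Psi Ud0.

Lemma steady_ratioE : rc1 = phi Ud0 / phi (M *m Imax).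
Proof.
rewrite /rc1 /steady_ratio -/M; congr (_ / _).
by rewrite -mulmxA diagc_ones /phi mulmxA.
Qed.

Lemma steady_ratio_gt0 : 0 < \sum_k Ud0 k 0 / beta k 0 -> 0 < rc1.
Proof. by rewrite -phiE steady_ratioE pmulr_lgt0// invr_gt0. Qed.

Lemma steady_ratio_neq0 : \sum_k Ud0 k 0 / beta k 0 != 0 -> rc1 != 0.
Proof.
by rewrite -phiE steady_ratioE => S0; rewrite mulf_neq0// invr_eq0 gt_eqF.
Qed.

Lemma steady_ratio_unique c : phi (M *m (c *: Imax)) = phi Ud0 -> c = rc1.
Proof.
rewrite phiM_scale steady_ratioE => <-.
by rewrite mulfK// gt_eqF.
Qed.

Lemma M_dec_current : M *m Idec = Ud0.
Proof.
apply: (can_inj (mulKmx Y_unit)); rewrite mulmxA YM.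
by rewrite /Idec /dec_current -mulmxA mulKVmx.
Qed.

(** [E + R Y] factors as [M Y], and [Ud0 = M Idec], so [M] cancels. *)
Lemma dec_voltageE : dec_voltage Y Rv Ud0 = invmx Y *m Idec.
Proof.
have E : 1%:M + Rv *m Y = M *m Y by rewrite mulmxDl mulVmx.
have MU : M \in unitmx.
  by move: B_unit; rewrite -YM unitmx_mul => /andP[].
rewrite /dec_voltage E -{1}M_dec_current.
have MYU : M *m Y \in unitmx by rewrite unitmx_mul MU.
apply: (can_inj (mulKmx MYU)); rewrite mulKVmx//.
by rewrite -mulmxA mulKVmx.
Qed.

Lemma dec_ratioE k : Rcr k 0 = Idec k 0 / Imax k 0.
Proof. by rewrite /Rcr /dec_ratio diagc_invmx// diagc_mulE mxE mulrC. Qed.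

Lemma dec_current_le_vmax : vle Idec (vmax Rcr *: Imax).
Proof.
by move=> k; rewrite [leRHS]mxE -ler_pdivrMr// -dec_ratioE vmax_ge.
Qed.

Lemma dec_current_ge_vmin : vle (vmin Rcr *: Imax) Idec.
Proof.
by move=> k; rewrite [leLHS]mxE -ler_pdivlMr// -dec_ratioE vmin_le.
Qed.

(** [1 - rc1] is a positive multiple of [phi (M (Imax - Idec))], and the functional is strictly
    positive on nonzero nonnegative vectors. *)
Lemma steady_ratio_lt1 : vle Idec Imax -> Idec != Imax -> rc1 < 1.
Proof.
move=> le ne; rewrite steady_ratioE ltr_pdivrMr// mul1r -M_dec_current.
rewrite -subr_gt0 -phiM_sub; apply: phiM_gt0; last first.
  by rewrite subr_eq0 eq_sym.
exact: vle_sub_ge0.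
Qed.

Lemma steady_ratio_bounds : vmin Rcr <= rc1 <= vmax Rcr.
Proof.
rewrite steady_ratioE ler_pdivlMr// ler_pdivrMr// -M_dec_current.
rewrite -!phiM_scale -subr_ge0 -[X in _ && X]subr_ge0 -!phiM_sub.
apply/andP; split; apply: phiM_ge0; apply: vle_sub_ge0.
  exact: dec_current_ge_vmin.
exact: dec_current_le_vmax.
Qed.

(** The monotone map [Y^-1], applied to [Idec <= vmax Rcr * Imax], compares the two voltages;
    [rc1 > 0] makes [vmax Rcr] positive as well. *)
Lemma steady_voltage_ge : 0 < rc1 ->
  vle ((rc1 / vmax Rcr) *: dec_voltage Y Rv Ud0) (rc1 *: (invmx Y *m Imax)).
Proof.
move=> r0 k; have /andP[_ rmax] := steady_ratio_bounds.
have m0 := lt_le_trans r0 rmax.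
rewrite dec_voltageE [leLHS]mxE [leRHS]mxE -mulrA ler_pM2l//.
rewrite mulrC ler_pdivrMr//.
have := conductance_invmx_le G_ge0 conn shunt_neq0 dec_current_le_vmax k.
by rewrite -scalemxAr [leRHS]mxE mulrC.
Qed.

Lemma steady_voltage_le : 0 < vmin Rcr ->
  vle (rc1 *: (invmx Y *m Imax)) ((rc1 / vmin Rcr) *: dec_voltage Y Rv Ud0).
Proof.
move=> m0 k; have /andP[rmin _] := steady_ratio_bounds.
have r0 := lt_le_trans m0 rmin.
rewrite dec_voltageE [leLHS]mxE [leRHS]mxE -mulrA ler_pM2l//.
rewrite mulrC ler_pdivlMr//.
have := conductance_invmx_le G_ge0 conn shunt_neq0 dec_current_ge_vmin k.
by rewrite -scalemxAr [leLHS]mxE mulrC.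
Qed.

(** * Uniform parameters, and equal output voltages *)

Lemma steady_ratio_uniform b r : Psi = b%:M -> Rv = r%:M ->
  rc1 = entry_sum Ud0 /
    (\sum_k (invmx Y *m ones R n.+1) k 0 * Imax k 0 + r * entry_sum Imax).
Proof.
move=> Pb Rr.
have b_k k : beta k 0 = b.
  by have /matrixP/(_ k k) := Pb; rewrite !mxE eqxx !mulr1n.
have b0 : b != 0 by rewrite -(b_k ord0) gt_eqF.
have phib v : phi v = entry_sum v / b.
  by rewrite phiE mulr_suml; apply: eq_bigr => k _; rewrite b_k.
rewrite steady_ratioE !phib -mulf_div divff ?mulr1 ?invr_eq0//.
congr (_ / _); rewrite /M Rr mulmxDl mul_scalar_mx -ones_dot mulmxDr mxE.
congr (_ + _); last by rewrite -scalemxAr mxE ones_dot.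
rewrite mulmxA mxE; apply: eq_bigr => k _; congr (_ * _).
(* Symmetry of [Y] passes to its inverse, whose column sums are thus its row sums. *)
have -> : invmx Y *m ones R n.+1 = ((ones R n.+1)^T *m invmx Y)^T.
  by rewrite trmx_mul trmxK trmx_inv conductance_sym.
by rewrite [RHS]mxE.
Qed.

Lemma entry_sum_Imax_gt0 : 0 < entry_sum Imax.
Proof.
rewrite /entry_sum big_ord_recl/= ltr_wpDr//.
by rewrite sumr_ge0// => k _; rewrite ltW.
Qed.

Lemma steady_ratio_lt_max_eigenvalue b r lambda :
  (1 < n.+1)%N -> 0 < entry_sum Ud0 ->
  Psi = b%:M -> Rv = r%:M -> max_eigenvalue Y lambda ->
  rc1 < entry_sum Ud0 / entry_sum Imax * (lambda / (1 + lambda * r)).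
Proof.
move=> n1 S0 Pb Rr lmax.
have r_gt0 : 0 < r.
  have /matrixP/(_ ord0 ord0) := Rr; rewrite !mxE eqxx !mulr1n => <-.
  exact: res_gt0.
have [k Gk wk] := conductance_invmx_ones_ge G_ge0 conn shunt_neq0.
(* The strictness of the bound arises here: [Y k k] exceeds the shunt by the branch conductances at
   [k]. *)
have lk : G k k < lambda.
  apply: lt_le_trans
    (sym_diag_le_max_eigenvalue k (conductance_sym G_sym) lmax).
  rewrite conductance_mxE eqxx ltrDl lt0r sumr_ge0// andbT.
  (* If those sum to 0, node [k] is isolated, and connectivity makes it the only node, against
     [n1]. *)
  apply/eqP => /psumr_eq0P G0.
  have : forall j, pred1 k j.
    apply: (connected_ind (k0 := k) conn) => [|i j /eqP -> jk].
      exact: eqxx.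
    by rewrite G0// ltxx.
  move=> all_k; suff : ord0 = Ordinal n1 by move/(congr1 val).
  by rewrite (eqP (all_k ord0)) (eqP (all_k (Ordinal n1))).
have l0 := lt_trans Gk lk.
have I0 := entry_sum_Imax_gt0.
rewrite (steady_ratio_uniform Pb Rr); set W := \sum_k _.
have W1 : entry_sum Imax / lambda < W.
  rewrite /entry_sum mulr_suml; apply: ltr_sum => [|i _].
    by apply/hasP; exists ord0; rewrite ?mem_index_enum.
  by rewrite mulrC ltr_pM2r// (lt_le_trans _ (wk i))// ltf_pV2.
have -> : entry_sum Ud0 / entry_sum Imax * (lambda / (1 + lambda * r)) =
    entry_sum Ud0 / (entry_sum Imax / lambda + r * entry_sum Imax).
  by field; rewrite !gt_eqF// ?addr_gt0 ?mulr_gt0//.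
have d0 : 0 < entry_sum Imax / lambda + r * entry_sum Imax.
  by rewrite addr_gt0 ?divr_gt0 ?mulr_gt0.
have d1 : entry_sum Imax / lambda + r * entry_sum Imax < W + r * entry_sum Imax.
  by rewrite ltrD2r.
by rewrite ltr_pM2l// ltf_pV2// posrE// (lt_trans d0 d1).
Qed.

Lemma steady_ratio_uniform_shunt g b r :
  shunt_mx G = g%:M -> Psi = b%:M -> Rv = r%:M ->
  rc1 = entry_sum Ud0 / entry_sum Imax * (g / (1 + g * r)).
Proof.
move=> Gg Pb Rr.
have r_gt0 : 0 < r.
  have /matrixP/(_ ord0 ord0) := Rr; rewrite !mxE eqxx !mulr1n => <-.
  exact: res_gt0.
have Gkk k : G k k = g.
  by have /matrixP/(_ k k) := Gg; rewrite !mxE eqxx !mulr1n.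
have g0 : 0 < g by have [k] := shunt_gt0 G_ge0 shunt_neq0; rewrite Gkk.
(* With equal shunts the ones vector is an eigenvector of [Y] for [g]. *)
have Y1 : invmx Y *m ones R n.+1 = g^-1 *: ones R n.+1.
  apply: (can_inj (mulKmx Y_unit)); apply/colP => k.
  rewrite -scalemxAr [RHS]mxE [in RHS]conductance_mulE Gkk.
  rewrite big1 ?addr0 => [|j _].
    by rewrite mulKVmx// !mxE mulr1 mulVf// gt_eqF.
  by rewrite !mxE subrr mulr0.
rewrite (steady_ratio_uniform Pb Rr) Y1.
have -> : \sum_k (g^-1 *: ones R n.+1) k 0 * Imax k 0 = g^-1 * entry_sum Imax.
  by rewrite mulr_sumr; apply: eq_bigr => k _; rewrite !mxE mulr1.
have I0 := entry_sum_Imax_gt0.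
by field; rewrite !gt_eqF// ?addr_gt0 ?mulr_gt0//.
Qed.

(** On constant vectors [Y] acts as [shunt_mx G] alone, so [Y x = Imax] with [x] constant says that
    [Imax] is a multiple of the shunts. *)
Lemma steady_voltage_const_iff (c : R) : c != 0 ->
  (forall k j, (c *: (invmx Y *m Imax)) k 0 = (c *: (invmx Y *m Imax)) j 0) <->
  exists2 eps : R, 0 < eps & Upsilon = eps *: shunt_mx G.
Proof.
move=> c0; set x := invmx Y *m Imax.
have Yx : Y *m x = Imax by rewrite mulKVmx.
split=> [xc|[eps eps0 UE] k j]; last first.
  suff -> : x = eps *: ones R n.+1 by rewrite !mxE.
  apply: (can_inj (mulKmx Y_unit)); rewrite Yx; apply/colP => i.
  rewrite -scalemxAr mxE conductance_mulE big1 ?addr0 => [|l _]; last first.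
    by rewrite !mxE subrr mulr0.
  have /matrixP/(_ i i) := UE; rewrite !mxE eqxx !mulr1n => ->.
  by rewrite mulr1.
have {}xc k j : x k 0 = x j 0.
  by have := xc k j; rewrite !mxE => /(mulfI c0).
have IE k : Imax k 0 = x ord0 0 * G k k.
  rewrite -Yx conductance_mulE big1 ?addr0 => [|l _]; last first.
    by rewrite (xc l k) subrr mulr0.
  by rewrite (xc k ord0) mulrC.
exists (x ord0 0).
  by have := Imax_gt0 ord0; rewrite IE; have := G_ge0 ord0 ord0; nra.
move: (x ord0 0) IE => e IE; apply/matrixP => k j; rewrite !mxE.
by case: eqP => _; rewrite ?mulr1n ?mulr0n ?mulr0// IE.
Qed.

(** * Equilibria, conserved quantity and limit of the closed loop *)

Context (tau alpha : 'cV[R]_n.+1).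
Hypothesis tau_gt0 : forall k, 0 < tau k 0.
Let D := diagc tau.
Let Phi := diagc alpha.
Let A := closed_loop_mx Y D Rv Upsilon Phi Psi.

(** The first block row gives [B Il = Y Ul]. This cancels the [Phi] terms of the second row and
    leaves [Psi L Upsilon^-1 Il = 0], so the current ratios agree. *)
Lemma closed_loop_kernel (Il Ul : 'cV[R]_n.+1) :
  A *m col_mx Il Ul = 0 ->
  [/\ Ul = M *m Il, L *m invmx Upsilon *m Il = 0 & exists c, Il = c *: Imax].
Proof.
rewrite /A /closed_loop_mx -/B -/L mul_block_col -col_mx0 => /eq_col_mx[].
rewrite mulNmx mulNmx => /eqP; rewrite addrC subr_eq0 -!mulmxA => /eqP.
move/(can_inj (mulKVmx (diagc_unit tau_gt0))) => BI.
have UE : Ul = M *m Il by apply: (can_inj (mulKmx Y_unit)); rewrite mulmxA YM.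
rewrite mulmxDl mulNmx -!mulmxA BI addrK => /eqP; rewrite oppr_eq0 => /eqP LI.
have {}LI : L *m (invmx Upsilon *m Il) = 0.
  by apply: (can_inj (mulKmx (diagc_unit beta_gt0))); rewrite mulmx0.
split; rewrite -?mulmxA//.
exists ((invmx Upsilon *m Il) ord0 0); apply/colP => k.
rewrite mxE (info_laplacian_kernel LI ord0 k) diagc_invmx// diagc_mulE mxE.
by rewrite mulrAC mulVf ?mul1r// gt_eqF.
Qed.

Let inv_row : 'rV[R]_(n.+1 + n.+1) :=
  row_mx ((ones R n.+1)^T *m invmx Psi *m Phi *m L *m invmx Upsilon)
         ((ones R n.+1)^T *m invmx Psi).

(** Adding [Phi L Upsilon^-1] times the first block row to the second leaves [- Psi L Upsilon^-1]
    and 0; then [1^T Psi^-1] annihilates the rest because [1^T L = 0]. *)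
Lemma closed_loop_invariant : inv_row *m A = 0.
Proof.
rewrite /A /closed_loop_mx -/B -/L mul_row_block -row_mx0; congr row_mx.
  rewrite [X in _ + X]mulmxDr !mulmxN !mulmxA mulmxKV ?diagc_unit//.
  by rewrite info_laplacian_ones_left mul0mx oppr0 add0r addNr.
by rewrite !mulmxN !mulmxA subrr.
Qed.

Context (Im Ud : R -> 'cV[R]_n.+1).

Lemma closed_loop_limit :
  semistable A -> trajectory A (fun t => col_mx (Im t) (Ud t)) ->
  Im 0 = 0 -> Ud 0 = Ud0 ->
  Im t @[t --> +oo] --> rc1 *: Imax /\
  Ud t - Rv *m Im t @[t --> +oo] --> rc1 *: (invmx Y *m Imax).
Proof.
move=> sA zA I0 U0.
have /cvg_ex[/= zl] := sA _ zA; rewrite -[zl]vsubmxK.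
set Il := usubmx zl; set Ul := dsubmx zl => zzl.
have [UE LI [c IE]] := closed_loop_kernel (trajectory_lim_ker zA zzl).
have := trajectory_lim_invariant zA closed_loop_invariant zzl.
(* The Laplacian term vanishes at time 0 because [Im 0 = 0] and at the limit by [LI], so
   conservation reads [phi Ul = phi Ud0]. *)
rewrite !mul_row_col I0 mulmx0 add0r U0 -!mulmxA (mulmxA L) LI !mulmx0 add0r.
rewrite !mulmxA => /(congr1 (fun v : 'M[R]_1 => v 0 0)).
rewrite -/(phi _) -/(phi _).
rewrite UE IE => /steady_ratio_unique <-; rewrite -IE; split.
  pose P : 'M[R]_(n.+1, n.+1 + n.+1) := row_mx 1%:M 0.
  have : P *m col_mx (Im t) (Ud t) @[t --> +oo] --> P *m col_mx Il Ul.
    exact: cvg_mulmxr.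
  rewrite mul_row_col mul1mx mul0mx addr0.
  by under eq_fun do rewrite mul_row_col mul1mx mul0mx addr0.
(* This row reads off the output voltage, whose limit is [Ul - R Il = Y^-1 Il]. *)
have : row_mx (- Rv) 1%:M *m col_mx (Im t) (Ud t) @[t --> +oo] -->
    row_mx (- Rv) 1%:M *m col_mx Il Ul by exact: cvg_mulmxr.
rewrite mul_row_col mul1mx UE mulmxDl mulNmx addrC addrK scalemxAr -IE.
by under eq_fun do rewrite mul_row_col mul1mx mulNmx addrC.
Qed.

End microgrid.

(** The side conditions exclude degenerate cases: [Idec = Imax] gives [rc1 = 1]; in P2 they make the
    divisors positive; in P3 a single node or a zero voltage sum gives equality and a negative sum
    reverses the inequality; in P5 a zero weighted sum gives [U = 0] for any shunts. *)
Theorem corollary1 (R : realType) (n : nat) (G : 'M[R]_n.+1)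
    (tau res Imax alpha beta : 'cV[R]_n.+1)
    (Im Ud : R -> 'cV[R]_n.+1)
    (G_sym : forall k j, G k j = G j k)
    (G_ge0 : forall k j, 0 <= G k j)
    (tau_gt0 : forall k, 0 < tau k 0)
    (res_gt0 : forall k, 0 < res k 0)
    (Imax_gt0 : forall k, 0 < Imax k 0)
    (alpha_gt0 : forall k, 0 < alpha k 0)
    (beta_gt0 : forall k, 0 < beta k 0) :
  let Y := conductance_mx G in
  let Ys := shunt_mx G in
  let D := diagc tau in
  let Rv := diagc res in
  let Upsilon := diagc Imax in
  let Phi := diagc alpha in
  let Psi := diagc beta in
  let A := closed_loop_mx Y D Rv Upsilon Phi Psi in
  network_connected G ->
  semistable A ->
  trajectory A (fun t => col_mx (Im t) (Ud t)) ->
  Im 0 = 0 ->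
  Ys != 0 ->
  let Ud0 := Ud 0 in
  let Idec := dec_current Y Rv Ud0 in
  let Uss := dec_voltage Y Rv Ud0 in
  let Rcr := dec_ratio Y Rv Upsilon Ud0 in
  let rc1 := steady_ratio Y Rv Upsilon Psi Ud0 in
  let U := rc1 *: (invmx Y *m Upsilon *m ones R n.+1) in
  [/\ forall k, Im t k 0 / Imax k 0 @[t --> +oo] --> rc1
    & Ud t - Rv *m Im t @[t --> +oo] --> U] /\
  [/\ (* P1 *)
      vle Idec Imax ->
        (Idec != Imax -> rc1 < 1) /\ vmin Rcr <= rc1 <= vmax Rcr,
      (* P2 *)
      vle Idec Imax ->
        (0 < \sum_k Ud0 k 0 / beta k 0 -> vle ((rc1 / vmax Rcr) *: Uss) U) /\
        (0 < vmin Rcr -> vle U ((rc1 / vmin Rcr) *: Uss)),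
      (* P3 *)
      (1 < n.+1)%N -> 0 < entry_sum Ud0 ->
      forall b r lambda : R, Psi = b%:M -> Rv = r%:M -> max_eigenvalue Y lambda ->
        rc1 < entry_sum Ud0 / entry_sum Imax * (lambda / (1 + lambda * r)),
      (* P4 *)
      forall g b r : R, Ys = g%:M -> Psi = b%:M -> Rv = r%:M ->
        rc1 = entry_sum Ud0 / entry_sum Imax * (g / (1 + g * r))
    & (* P5 *)
      \sum_k Ud0 k 0 / beta k 0 != 0 ->
      ((forall k j, U k 0 = U j 0) <->
       exists2 eps : R, 0 < eps & Upsilon = eps *: Ys)].
Proof.
move=> Y Ys D Rv Upsilon Phi Psi A conn sA zA I0 Ys0 Ud0 Idec Uss Rcr rc1 U.
have UE : U = rc1 *: (invmx Y *m Imax) by rewrite /U -mulmxA diagc_ones.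
have [IT UT] := closed_loop_limit G_sym G_ge0 conn Ys0 res_gt0 Imax_gt0 beta_gt0
  tau_gt0 sA zA I0 erefl.
have rc1_gt0 : 0 < \sum_k Ud0 k 0 / beta k 0 -> 0 < rc1.
  exact: steady_ratio_gt0.
split; first split; last split.
- move=> k; have -> : rc1 = (rc1 *: Imax) k 0 / Imax k 0.
    by rewrite [X in X / _]mxE mulfK// gt_eqF.
  by apply: cvgMr_tmp; exact: ((cvg_mx_coord _ _).1 IT).
- by rewrite UE.
- by move=> le; split; [exact: steady_ratio_lt1|exact: steady_ratio_bounds].
- by rewrite UE => _; split=> [/rc1_gt0|];
    [exact: steady_voltage_ge|exact: steady_voltage_le].
- by move=> n1 S0 b r lambda; exact: steady_ratio_lt_max_eigenvalue.
- by move=> g b r; exact: steady_ratio_uniform_shunt.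
- move=> S0; rewrite UE; apply: steady_voltage_const_iff => //.
  exact: steady_ratio_neq0.
Qed.
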